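(* Let $\mathbf{M}$ be a nonsingular $n\times n$ integer matrix and let $A\subseteq \mathbb{Z}^n/\mathbf{M}\mathbb{Z}^n$. Let $\mathbf{H}=\mathbf{M}\mathbf{V}$ ($\mathbf{V}$ unimodular) be the Hermite normal form of $\mathbf{M}$, and let $\mathbf{S}=\mathrm{diag}(s_1,\dots,s_n)=\mathbf{U}\mathbf{M}\mathbf{V}'$ (with $\mathbf{U},\mathbf{V}'$ unimodular integer matrices) be the Smith normal form of $\mathbf{M}$. Let $r$ be the number of indices $i$ with $s_i\neq 1$, so that $s_1=\dots=s_{n-r}=1$ and $s_{n-r+1},\dots,s_n>1$. Let $\mathbf{S}'=\mathrm{diag}(s_{n-r+1},\dots,s_n)$ and let $\mathbf{U}'$ be the $r\times n$ matrix formed by the last $r$ rows of $\mathbf{U}$. Put $\phi(A)=\{\mathbf{U}'\mathbf{a} : \mathbf{a}\in A\}$ (taken modulo $\mathbf{S}'$). Then the multidimensional circulants $G(\mathbf{M};A)$, $G(\mathbf{H};A)$ and $G(\mathbf{S}';\phi(A))$ are pairwise Ádám isomorphic. (This holds both for digraphs, and for graphs when $A=-A$.)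
   Context: For a nonsingular $\mathbf{M}\in\mathbb{Z}^{n\times n}$, vectors $\mathbf{a},\mathbf{b}\in\mathbb{Z}^n$ are congruent modulo $\mathbf{M}$ if $\mathbf{a}-\mathbf{b}\in\mathbf{M}\mathbb{Z}^n$ (the lattice spanned by the columns of $\mathbf{M}$); $\mathbb{Z}^n/\mathbf{M}\mathbb{Z}^n$ is the resulting finite abelian group. Note $\mathbf{M}\mathbb{Z}^n=\mathbf{H}\mathbb{Z}^n$, so $A$ is also a subset of $\mathbb{Z}^n/\mathbf{H}\mathbb{Z}^n$. For $A\subseteq\mathbb{Z}^n/\mathbf{M}\mathbb{Z}^n$, the multidimensional circulant digraph $G(\mathbf{M};A)$ has vertex set $\mathbb{Z}^n/\mathbf{M}\mathbb{Z}^n$ and an arc from $\mathbf{u}$ to $\mathbf{u}+\mathbf{a} \pmod{\mathbf{M}}$ for each $\mathbf{a}\in A$; when $A=-A$ it is regarded as a graph (multidimensional circulant graph). The Hermite normal form of $\mathbf{M}$ is the unique upper triangular matrix $\mathbf{H}=\mathbf{M}\mathbf{V}$, $\mathbf{V}$ unimodular, with positive diagonal entries and with each entry above the diagonal in $\{0,\dots,h_{ii}-1\}$. The Smith normal form is the unique diagonal matrix $\mathrm{diag}(s_1,\dots,s_n)$ equivalent to $\mathbf{M}$ (i.e. $=\mathbf{U}\mathbf{M}\mathbf{V}'$ with $\mathbf{U},\mathbf{V}'$ unimodular) with positive $s_i$ and $s_i\mid s_{i+1}$. Two multidimensional circulants $G(\mathbf{M};A)$ and $G(\mathbf{M}';A')$,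 with $\mathbf{M}\in\mathbb{Z}^{n\times n}$, $\mathbf{M}'\in\mathbb{Z}^{n'\times n'}$, are Ádám isomorphic if there is a group isomorphism $\psi:\mathbb{Z}^n/\mathbf{M}\mathbb{Z}^n\to\mathbb{Z}^{n'}/\mathbf{M}'\mathbb{Z}^{n'}$ with $\psi(A)=A'$. *)

(* Defs.v *)
From HB Require Import structures.
From mathcomp Require Import all_boot all_order all_algebra.
From mathcomp Require Import boolp classical_sets.
Set Implicit Arguments.
Unset Strict Implicit.
Unset Printing Implicit Defensive.
Import Order.TTheory GRing.Theory Num.Theory.
Local Open Scope quotient_scope.
Local Open Scope classical_set_scope.
Local Open Scope ring_scope.

(* Integer vectors are columns; [lattice M] is M Z^n, spanned by the columns
   of M. *)
Definition lattice n (M : 'M[int]_n) : {pred 'cV[int]_n} :=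
  [pred v | `[< exists x : 'cV[int]_n, v = M *m x >]].

Lemma lattice_zmod_closed n (M : 'M[int]_n) : zmod_closed (lattice M).
Proof.
split; first by apply/asboolP; exists 0; rewrite mulmx0.
move=> u v /asboolP[x ->] /asboolP[y ->].
by apply/asboolP; exists (x - y); rewrite mulmxBr.
Qed.

HB.instance Definition _ n (M : 'M[int]_n) :=
  GRing.isZmodClosed.Build 'cV[int]_n (lattice M) (lattice_zmod_closed M).

(* Z^n / M Z^n, with the quotient group structure of [ring_quotient]. *)
Notation Zmod M := {ideal_quot lattice M}.

Definition cls n (M : 'M[int]_n) (v : 'cV[int]_n) : Zmod M := \pi_(Zmod M) v.

Lemma clsP n (M : 'M[int]_n) (u v : 'cV[int]_n) :
  cls M u = cls M v <-> exists x : 'cV[int]_n, u - v = M *m x.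
Proof.
split=> [/eqP|uv]; last by apply/eqP; rewrite -Quotient.idealrBE; apply/asboolP.
by rewrite -Quotient.idealrBE => /asboolP.
Qed.

Definition reps n (M : 'M[int]_n) (A : set (Zmod M)) : set 'cV[int]_n :=
  [set v | A (cls M v)].

(* G(M; A).  Adam isomorphism depends on the presentation (M; A), not only on
   the digraph, so the presentation is what is recorded; [circ_arc] is its
   arc relation. *)
Record circulant := Circulant {
  cdim : nat;
  cmat : 'M[int]_cdim;
  cnonsing : \det cmat != 0;
  cset : set (Zmod cmat) }.

Arguments cset : clear implicits.

Definition circ_arc (G : circulant) (u v : Zmod (cmat G)) : Prop :=
  exists2 a, cset G a & v = u + a.

Definition is_graph (G : circulant) : Prop := cset G = [set - a | a in cset G].

Definition adam_iso (G G' : circulant) : Prop :=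
  exists psi : {additive Zmod (cmat G) -> Zmod (cmat G')},
    bijective psi /\ psi @` cset G = cset G'.

Lemma is_graph_arc_sym (G : circulant) (u v : Zmod (cmat G)) :
  is_graph G -> circ_arc u v -> circ_arc v u.
Proof.
move=> Gg [a Aa ->]; exists (- a); last by rewrite addrK.
by rewrite Gg; exists a.
Qed.

Lemma adam_iso_arc (G G' : circulant) : adam_iso G G' ->
  exists2 psi : Zmod (cmat G) -> Zmod (cmat G'),
    bijective psi & forall u v, circ_arc u v <-> circ_arc (psi u) (psi v).
Proof.
case=> psi [psi_bij psiA]; exists psi => // u v; split=> [[a Aa ->]|[b]].
  by exists (psi a); rewrite ?raddfD // -psiA; exists a.
rewrite -psiA => -[a Aa <-]; rewrite -raddfD => /(bij_inj psi_bij) ->.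
by exists a.
Qed.

Definition is_hnf n (M V H : 'M[int]_n) : Prop :=
  [/\ V \in unitmx,
      H = M *m V,
      (forall i j : 'I_n, (j < i)%N -> H i j = 0),
      (forall i : 'I_n, 0 < H i i) &
      (forall i j : 'I_n, (i < j)%N -> 0 <= H i j < H i i)].

Definition is_snf n (M U V' : 'M[int]_n) (s : 'rV[int]_n) : Prop :=
  [/\ U \in unitmx,
      V' \in unitmx,
      diag_mx s = U *m M *m V',
      (forall i : 'I_n, 0 < s 0 i) &
      (forall i j : 'I_n, j = i.+1 :> nat -> (s 0%R i %| s 0%R j)%Z)].

Definition snf_rank n (s : 'rV[int]_n) : nat := #|[pred i | s 0 i != 1]|.

Lemma snf_rank_le n (s : 'rV[int]_n) : (snf_rank s <= n)%N.
Proof. by rewrite -[n in leqRHS]card_ord max_card. Qed.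

(* The i-th of the last [snf_rank s] indices, i.e. n - r + i. *)
Definition last_ord n (s : 'rV[int]_n) (i : 'I_(snf_rank s)) : 'I_n :=
  cast_ord (subnK (snf_rank_le s)) (rshift (n - snf_rank s) i).

Definition snf_reduced n (s : 'rV[int]_n) : 'M[int]_(snf_rank s) :=
  diag_mx (colsub (@last_ord n s) s).

Definition last_rows n (s : 'rV[int]_n) (U : 'M[int]_n) :
    'M[int]_(snf_rank s, n) :=
  rowsub (@last_ord n s) U.

Lemma hnf_nonsing n (M V H : 'M[int]_n) :
  \det M != 0 -> is_hnf M V H -> \det H != 0.
Proof.
move=> M0 [Vu -> _ _ _]; rewrite det_mulmx mulf_neq0 //.
by apply: contraTneq Vu => V0; rewrite unitmxE V0 unitr0.
Qed.

Lemma snf_reduced_nonsing n (M U V' : 'M[int]_n) (s : 'rV[int]_n) :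
  is_snf M U V' s -> \det (snf_reduced s) != 0.
Proof.
case=> _ _ _ s0 _; rewrite det_diag; apply/prodf_neq0 => i _.
by rewrite mxE gt_eqF.
Qed.

(* Main.v *)
(** Multiplication by [U] carries M Z^n onto S Z^n, and the coordinates with
    s_i = 1 vanish in Z^n / S Z^n; hence v |-> U' v induces an isomorphism
    Z^n / M Z^n -> Z^r / S' Z^r, while M Z^n = H Z^n. *)
Require Import Defs.
From HB Require Import structures.
From mathcomp Require Import all_boot all_order all_algebra.
From mathcomp Require Import boolp classical_sets.
From mathcomp Require Import zify.
Set Implicit Arguments.
Unset Strict Implicit.
Unset Printing Implicit Defensive.
Import Order.TTheory GRing.Theory Num.Theory.
Local Open Scope quotient_scope.
Local Open Scope classical_set_scope.
Local Open Scope ring_scope.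

Lemma latticeP n (M : 'M[int]_n) (v : 'cV[int]_n) :
  reflect (exists x, v = M *m x) (v \in lattice M).
Proof. exact: asboolP. Qed.

Lemma eq_cls n (M : 'M[int]_n) (u v : 'cV[int]_n) :
  cls M u = cls M v <-> u - v \in lattice M.
Proof. by rewrite clsP; split=> /latticeP. Qed.

Lemma cls_repr n (M : 'M[int]_n) (x : Zmod M) : cls M (repr x) = x.
Proof. exact: reprK. Qed.

Lemma clsB n (M : 'M[int]_n) : {morph cls M : u v / u - v}.
Proof. by move=> u v; rewrite /cls raddfB. Qed.

(** The equality of memberships works in both directions: from [M] to [N] it makes the induced map
    well defined, from [N] to [M] it makes it injective. The second hypothesis gives
    surjectivity. *)
Lemma cls_mulmx_iso m n (M : 'M[int]_n) (N : 'M[int]_m) (P : 'M[int]_(m, n)) :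
  (forall v : 'cV_n, (P *m v \in lattice N) = (v \in lattice M)) ->
  (forall w : 'cV_m, exists v : 'cV_n, P *m v = w) ->
  exists psi : {additive Zmod M -> Zmod N},
    bijective psi /\ forall v, psi (cls M v) = cls N (P *m v).
Proof.
move=> PMN Psurj.
pose psi (x : Zmod M) := cls N (P *m repr x).
have psiE v : psi (cls M v) = cls N (P *m v).
  by apply/eq_cls; rewrite -mulmxBr PMN; apply/eq_cls; rewrite cls_repr.
have psiB : zmod_morphism psi.
  move=> x y; rewrite -(cls_repr x) -(cls_repr y) -clsB !psiE.
  by rewrite mulmxBr clsB.
pose psi_add := GRing.isZmodMorphism.Build _ _ psi psiB.
pose psi' : {additive Zmod M -> Zmod N} := HB.pack psi psi_add.
(* [g] is a set-theoretic section of [P], not assumed additive; its ambiguity lies in the kernel of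
   [P], which is contained in [lattice M]. *)
have [g gK] := choice Psurj.
exists psi'; split=> //; exists (fun y => cls M (g (repr y))) => [x|y] /=.
  rewrite -[RHS]cls_repr; apply/eq_cls; rewrite -PMN mulmxBr gK.
  by apply/eq_cls; rewrite cls_repr.
by rewrite psiE gK cls_repr.
Qed.

Lemma lattice_mulmx_unit n (M V : 'M[int]_n) :
  V \in unitmx -> lattice (M *m V) =i lattice M.
Proof.
move=> Vu v; apply/latticeP/latticeP => -[x ->].
  by exists (V *m x); rewrite mulmxA.
by exists (invmx V *m x); rewrite mulmxA mulmxK.
Qed.

Lemma lattice_unit_mulmx n (M U : 'M[int]_n) (v : 'cV[int]_n) :
  U \in unitmx -> (U *m v \in lattice (U *m M)) = (v \in lattice M).
Proof.
move=> Uu; apply/latticeP/latticeP => -[x vE]; exists x.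
  by rewrite -(mulKmx Uu v) vE -mulmxA mulKmx.
by rewrite vE mulmxA.
Qed.

Lemma lattice_diagP n (s : 'rV[int]_n) (v : 'cV[int]_n) :
  reflect (forall i, (s 0%R i %| v i 0%R)%Z) (v \in lattice (diag_mx s)).
Proof.
apply: (iffP (latticeP _ _)) => [[x ->] i|sv].
  by rewrite mul_diag_mx mxE dvdz_mulr.
exists (\col_i (v i 0%R %/ s 0%R i)%Z); apply/colP => i.
by rewrite mul_diag_mx !mxE mulrC divzK.
Qed.

Lemma card_ord_lt_le n (i : nat) : (#|[pred j : 'I_n | (j < i)%N]| <= i)%N.
Proof.
rewrite -[leqRHS](size_iota 0) cardE -(size_map val).
apply: uniq_leq_size; first by rewrite (map_inj_uniq val_inj) enum_uniq.
by move=> _ /mapP[j + ->]; rewrite mem_enum mem_iota.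
Qed.

Section SmithReduction.

Variables (n : nat) (M U V' : 'M[int]_n) (s : 'rV[int]_n).
Hypothesis snfS : is_snf M U V' s.

(** Consecutive divisibilities chain together by induction on the value of [j]. *)
Lemma snf_dvd (i j : 'I_n) : (i <= j)%N -> (s 0%R i %| s 0%R j)%Z.
Proof.
case: snfS => _ _ _ _ sdvd.
case: j => j; elim: j => [|j IHj] jn /=.
  by rewrite leqn0 => /eqP i0; rewrite (_ : i = Ordinal jn) //; apply: val_inj.
rewrite leq_eqVlt ltnS => /predU1P[ij|ij].
  by rewrite (_ : i = Ordinal jn) //; apply: val_inj.
exact: dvdz_trans (IHj (ltnW jn) ij) (sdvd _ _ _).
Qed.

(** Contrapositive by counting: if [s 0 i] is not 1, every index carrying a 1 lies strictly below
    [i], so there are at most [i] of them, and their number is [n - snf_rank s]. *)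
Lemma snf_small (i : 'I_n) : (i < n - snf_rank s)%N -> s 0 i = 1.
Proof.
move=> i_small; apply/eqP; apply: contraLR i_small => si.
have [_ _ _ s_gt0 _] := snfS.
have tail : (#|[predC [pred j | s 0%R j != 1%R]]| <= i)%N.
  apply: leq_trans (card_ord_lt_le n i); apply: subset_leq_card.
  apply/fintype.subsetP => j; rewrite !inE negbK => /eqP sj.
  rewrite ltnNge; apply: contra si => ij.
  (* A later entry equal to 1 would be divisible by [s 0 i], which positivity then forces to be
     1. *)
  have := snf_dvd ij; rewrite sj dvdz1 => /eqP s1.
  by rewrite -(gtr0_norm (s_gt0 i)) -abszE s1.
rewrite -leqNgt leq_subLR -[leqLHS]card_ord -(cardC [pred j | s 0 j != 1]).
by rewrite leq_add2l.
Qed.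

Lemma last_ord_inj : injective (@last_ord n s).
Proof. by move=> i j /cast_ord_inj/rshift_inj. Qed.

Lemma notin_codom_last_ord (i : 'I_n) :
  i \notin codom (@last_ord n s) -> (i < n - snf_rank s)%N.
Proof.
apply: contraR; rewrite -leqNgt => le_i.
have ltr : (i - (n - snf_rank s) < snf_rank s)%N.
  by have := ltn_ord i; have := snf_rank_le s; lia.
apply/codomP; exists (Ordinal ltr); apply: val_inj => /=.
by rewrite subnKC.
Qed.

Lemma last_rowsE (v : 'cV[int]_n) :
  last_rows s U *m v = rowsub (@last_ord n s) (U *m v).
Proof. by rewrite mul_rowsub_mx. Qed.

(** In the coordinates [U *m v], membership is divisibility by each [s 0 i]; the rows dropped have
    [s 0 i = 1] and impose no condition. *)
Lemma last_rows_lattice (v : 'cV[int]_n) :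
  (last_rows s U *m v \in lattice (snf_reduced s)) = (v \in lattice M).
Proof.
have [Uu V'u sE _ _] := snfS.
rewrite -(lattice_unit_mulmx M v Uu) -(lattice_mulmx_unit (U *m M) V'u) -sE.
rewrite last_rowsE.
apply/lattice_diagP/lattice_diagP => dvd_s i; last first.
  by have := dvd_s (last_ord i); rewrite !mxE.
have [/codomP[k ->]|/notin_codom_last_ord/snf_small ->] :=
  boolP (i \in codom (@last_ord n s)); last exact: dvd1z.
by have := dvd_s k; rewrite !mxE.
Qed.

Lemma last_rows_surj (w : 'cV[int]_(snf_rank s)) :
  exists v : 'cV[int]_n, last_rows s U *m v = w.
Proof.
have [Uu _ _ _ _] := snfS.
(* Pad [w] with zeros in the dropped coordinates, then undo [U]; any other filler would do, since
   only the last rows are read. *)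
pose u : 'cV[int]_n :=
  \col_i if [pick k | @last_ord n s k == i] is Some k then w k 0 else 0.
exists (invmx U *m u); rewrite last_rowsE mulKVmx //.
apply/colP => k; rewrite !mxE.
by case: pickP => [l /eqP/last_ord_inj -> //|/(_ k)]; rewrite eqxx.
Qed.

End SmithReduction.

Lemma adam_iso_mulmx (G G' : circulant) (P : 'M[int]_(cdim G', cdim G)) :
  (forall v, (P *m v \in lattice (cmat G')) = (v \in lattice (cmat G))) ->
  (forall w : 'cV_(cdim G'), exists v : 'cV_(cdim G), P *m v = w) ->
  cset G' = [set cls (cmat G') (P *m a) | a in reps (cset G)] ->
  adam_iso G G'.
Proof.
move=> Plattice Psurj G'A.
have [psi [psi_bij psiE]] := cls_mulmx_iso Plattice Psurj.
exists psi; split=> //; rewrite G'A.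
apply/seteqP; split=> [_ [x Ax <-]|_ [v Av <-]].
  by exists (repr x); rewrite /reps /= -?psiE cls_repr.
by exists (cls _ v); rewrite ?psiE.
Qed.

(** An additive map commutes with negation, so it carries a symmetric set to a symmetric set. *)
Lemma is_graph_adam_iso (G G' : circulant) :
  adam_iso G G' -> is_graph G -> is_graph G'.
Proof.
case=> psi [_ psiA] Gg; rewrite /is_graph -psiA image_comp {1}Gg image_comp.
by apply: eq_imagel => x _ /=; rewrite raddfN.
Qed.

Theorem theorem3p2 (n : nat) (M : 'M[int]_n) (nonsingM : \det M != 0)
    (A : set (Zmod M)) (V H : 'M[int]_n) (hnfH : is_hnf M V H)
    (U V' : 'M[int]_n) (s : 'rV[int]_n) (snfS : is_snf M U V' s) :
  let S' := snf_reduced s in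
  let U' := last_rows s U in
  let A_H : set (Zmod H) := [set cls H a | a in reps A] in
  let phiA : set (Zmod S') := [set cls S' (U' *m a) | a in reps A] in
  let G_M := Circulant nonsingM A in
  let G_H := Circulant (hnf_nonsing nonsingM hnfH) A_H in
  let G_S' := Circulant (snf_reduced_nonsing snfS) phiA in
  [/\ adam_iso G_M G_H, adam_iso G_H G_S' & adam_iso G_M G_S'] /\
  (is_graph G_M -> is_graph G_H /\ is_graph G_S').
Proof.
move=> S' U' A_H phiA G_M G_H G_S'.
have latticeH : lattice H =i lattice M.
  by have [Vu -> _ _ _] := hnfH; apply: lattice_mulmx_unit.
have MH : adam_iso G_M G_H.
  (* The two lattices coincide, so the identity matrix induces the isomorphism. *)
  apply: (@adam_iso_mulmx G_M G_H 1%:M) => [v|w|] /=.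
  - by rewrite mul1mx latticeH.
  - by exists w; rewrite mul1mx.
  - by apply: eq_imagel => a _; rewrite mul1mx.
have MS : adam_iso G_M G_S'.
  apply: (@adam_iso_mulmx G_M G_S' U') => //.
  - exact: last_rows_lattice snfS.
  - exact: last_rows_surj snfS.
(* Classes modulo [H] and modulo [M] are the same cosets, so passing to [A_H] adds no
   representatives. Hence [phiA], defined from [A], is also the image of [A_H], and [U'] serves
   again. *)
have A_HE : reps A_H = reps A.
  apply/seteqP; split=> [v [a Aa /eq_cls]|v Av]; last by exists v.
  by rewrite latticeH /reps /= => /eq_cls <-.
have HS : adam_iso G_H G_S'.
  apply: (@adam_iso_mulmx G_H G_S' U') => [v||] /=.
  - by rewrite latticeH; exact: last_rows_lattice snfS v.
  - exact: last_rows_surj snfS.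
  - by rewrite A_HE.
by split=> // Mg; split; [apply: is_graph_adam_iso MH Mg
                         | apply: is_graph_adam_iso MS Mg].
Qed.
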